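(* Let $n \ge 1$ be an integer and let $T_n$ be a Christmas Tree lattice with $n$ minimal elements. Then there exists an algebraic representation $\mathbf{A} = (A, F)$ of $T_n$ such that $A$ has $\frac{n^2+n+2}{2}$ elements and $F$ consists of $\frac{3n^2-3n+2}{2}$ functions.
   Context: An algebraic structure is a pair $\mathbf{A} = (A, F)$ where $A$ is a set and $F$ is a set of functions (operations), each of the form $f : A^m \to A$ for some $m \in \mathbb{N} \cup \{0\}$ (the arity $m$ may depend on $f$; a nullary operation, $m=0$, is a distinguished constant in $A$). A subalgebra of $\mathbf{A}$ is a subset $B \subseteq A$ closed under every operation in $F$ (in particular containing every nullary constant), with the restricted operations. The subalgebras of $\mathbf{A}$, ordered by set inclusion, form a lattice $\mathbf{Sub}(\mathbf{A})$. An algebraic representation of a lattice $L$ is an algebraic structure $\mathbf{A}$ such that $\mathbf{Sub}(\mathbf{A})$ is isomorphic to $L$ as a lattice. In a finite lattice with least element $0$ and greatest element $1$, ''minimal elements'' means the elements that cover $0$. A Christmas Tree lattice $T_n$ is a finite lattice such that: (T1) $T_n$ has exactly $n$ minimal elements $a_1, \dots, a_n$; (T2) for $1 \le i, j \le n$ with $i \ne j$, $a_i \wedge a_j = 0$; (T3) for every $b \in T_n \setminus \{0\}$ there is exactly one pair of indices $i, j$ with $1 \le i \le j \le n$ such that $a_i \vee a_j = b$ (the case $i=j$, giving $b = a_i$, is allowed); (T4) for all $1 \le i, j, k \le n$ with $i \ne k$, $a_i \vee a_j \ne a_k \vee a_j$; and for $i < k$, $a_i \vee a_k = a_i \vee a_{i+1}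 \vee \dots \vee a_k$. *)

(* Defs.v *)
From HB Require Import structures.
From mathcomp Require Import all_boot all_order.
From mathcomp Require Import boolp classical_sets cardinality.

Set Implicit Arguments.
Unset Strict Implicit.
Unset Printing Implicit Defensive.
Import Order.TTheory.

Local Open Scope classical_set_scope.

(* The arity is part of an operation; for m = 0 there is a unique argument
   'I_0 -> A, so a nullary operation is a distinguished constant. *)
Definition operation (A : Type) : Type := {m : nat & ('I_m -> A) -> A}.

(* The carrier may be any type, and the operations form a set, so that
   cardinalities of [ops] count distinct operations. *)
Record algStruct := AlgStruct {
  universe :> Type;
  ops : set (operation universe)
}.
Arguments ops : clear implicits.

Definition closed_under (A : Type) (f : operation A) (B : set A) : Prop :=
  forall x : 'I_(projT1 f) -> A, (forall i, B (x i)) -> B (projT2 f x).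

(* The empty set is a subalgebra exactly when there is no nullary operation. *)
Definition is_subalgebra (A : algStruct) (B : set A) : Prop :=
  forall f, ops A f -> closed_under f B.

Section SubLattice.
Variable A : algStruct.

Record subalgebra := Subalgebra {
  subalg_set :> set A;
  _ : `[< is_subalgebra subalg_set >]
}.

HB.instance Definition _ := [isSub for subalg_set].
HB.instance Definition _ := [Choice of subalgebra by <:].

Fact subalgebra_display : Order.disp_t. Proof. exact: Order.Disp tt tt. Qed.

(* The order on [set A] is inclusion. *)
HB.instance Definition _ :=
  [SubChoice_isSubPOrder of subalgebra by <: with subalgebra_display].

Lemma subalgebraP (B : subalgebra) : is_subalgebra B.
Proof. by case: B => B /= /asboolP. Qed.

Lemma subalgebra_leP (B C : subalgebra) :
  reflect (subalg_set B `<=` subalg_set C) (B <= C)%O.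
Proof. by rewrite -Order.le_val; apply: (iffP idP); rewrite subsetEset. Qed.

Lemma subalgebraI_subproof (B C : subalgebra) :
  `[< is_subalgebra (subalg_set B `&` subalg_set C) >].
Proof.
apply/asboolP => f Ff x xBC.
by split; apply: (subalgebraP Ff) => i; case: (xBC i).
Qed.

Lemma subalgebraU_subproof (B C : subalgebra) :
  `[< is_subalgebra
        (smallest (@is_subalgebra A) (subalg_set B `|` subalg_set C)) >].
Proof.
apply/asboolP => f Ff x xBC D [sD BCD].
by apply: (sD f Ff) => i; apply: (xBC i).
Qed.

Definition subalgebraI (B C : subalgebra) : subalgebra :=
  Subalgebra (subalgebraI_subproof B C).

Definition subalgebraU (B C : subalgebra) : subalgebra :=
  Subalgebra (subalgebraU_subproof B C).

Lemma subalgebra_lexI (B C D : subalgebra) :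
  (B <= subalgebraI C D)%O = (B <= C)%O && (B <= D)%O.
Proof.
apply/subalgebra_leP/andP => [BCD|[/subalgebra_leP BC /subalgebra_leP BD]].
  by split; apply/subalgebra_leP => x /BCD[].
by move=> x Bx; split; [apply: BC | apply: BD].
Qed.

Lemma subalgebra_leUx (B C D : subalgebra) :
  (subalgebraU B C <= D)%O = (B <= D)%O && (C <= D)%O.
Proof.
apply/subalgebra_leP/andP => [BCD|[/subalgebra_leP BD /subalgebra_leP CD]].
  by split; apply/subalgebra_leP => x xX; apply: BCD => E [_]; apply;
     [left | right].
move=> x; apply; split; first exact: subalgebraP.
by move=> y [/BD|/CD].
Qed.

HB.instance Definition _ :=
  Order.POrder_isMeetSemilattice.Build subalgebra_display subalgebra
    subalgebra_lexI.
HB.instance Definition _ :=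
  Order.POrder_isJoinSemilattice.Build subalgebra_display subalgebra
    subalgebra_leUx.

End SubLattice.

Definition lattice_isomorphic (d d' : Order.disp_t)
    (L : latticeType d) (L' : latticeType d') : Prop :=
  exists f : L -> L',
    [/\ bijective f, Order.meet_morphism f & Order.join_morphism f].

Definition algebraic_representation (d : Order.disp_t) (L : latticeType d)
    (A : algStruct) : Prop :=
  lattice_isomorphic (subalgebra A) L.

Local Close Scope classical_set_scope.
Local Open Scope order_scope.

Definition covers (d : Order.disp_t) (T : porderType d) (x y : T) : Prop :=
  x < y /\ forall z : T, ~ (x < z /\ z < y).

(* The minimal elements are enumerated as a 0, ..., a (n - 1). *)
Definition christmas_tree (n : nat) (d : Order.disp_t)
    (T : finTBLatticeType d) : Prop :=
  exists a : 'I_n -> T,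
    [/\ injective a /\
          (forall x : T, covers \bot x <-> exists i, a i = x),
        forall i j : 'I_n, i <> j -> a i `&` a j = \bot,
        forall b : T, b <> \bot ->
          exists! ij : 'I_n * 'I_n,
            (ij.1 <= ij.2)%N /\ a ij.1 `|` a ij.2 = b
      & (forall i j k : 'I_n, i <> k -> a i `|` a j <> a k `|` a j) /\
        (forall i k : 'I_n, (i < k)%N ->
           a i `|` a k = \join_(l < n | (i <= l <= k)%N) a l)].

(* Main.v *)
Require Import Defs.
From mathcomp Require Import all_boot all_order zify.
From mathcomp Require Import boolp classical_sets cardinality.

(** Write c i j for the join of a i and a j. Every nonzero element of T
    is c i j for exactly one pair i <= j, and as the join of a i, ..., a j it
    lies above all the a l with i <= l <= j. It lies above no other atom
    ([atom_le_joinE]), so T is the lattice of intervals of {1, ..., n}, with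
    the empty interval for 0. In particular T has 1 + n(n+1)/2 elements.

    The universe of the algebra is T itself, and x in T is to correspond to
    the subalgebra of all y <= x. So the operations have to force subalgebras
    to be the principal ideals of T. A requirement of the form: if B contains
    s_1, ..., s_m then it contains v, costs one operation, namely the m-ary one
    that sends (s_1, ..., s_m) to v and every other tuple to 0. A set
    containing 0 is closed under that operation exactly when it meets the
    requirement, and different requirements with v <> 0 give different
    operations. One constant forces 0 into B, and three requirements for each
    pair i < j suffice:
    - a i and a j imply c i j;
    - c i j implies a i;
    - c i j implies c (i+1) j.
    The last two strip an interval from the left, so that B contains every
    atom below any of its elements; the first one rebuilds from these atoms
    every smaller element and every join ([tree_implication_complete]). All
    this takes 1 + 3 n(n-1)/2 operations. *)

Local Open Scope classical_set_scope.

Set Implicit Arguments.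
Unset Strict Implicit.
Import Order.TTheory.

(** * Order isomorphisms and counting *)

Lemma order_iso_lattice_isomorphic (d d' : Order.disp_t)
    (L : latticeType d) (L' : latticeType d') (f : L -> L') (g : L' -> L) :
  cancel f g -> cancel g f -> {mono f : x y / (x <= y)%O} ->
  lattice_isomorphic L L'.
Proof.
move=> fK gK fle; exists f; split; first by exists g.
- move=> x y; apply: le_anti; rewrite lexI !fle leIl leIr /=.
  by rewrite -[X in (X <= _)%O]gK fle lexI -!fle gK leIl leIr.
- move=> x y; apply: le_anti; rewrite leUx !fle leUl leUr andbT.
  by rewrite -[X in (_ <= X)%O]gK fle leUx -!fle gK leUl leUr.
Qed.

Lemma card_finType (X : finType) : ([set: X] #= `I_#|X|)%card.
Proof.
apply: card_esym; apply: (card_eq_trans card_II).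
have := @inj_card_eq X 'I_#|X| setT enum_rank (in2W enum_rank_inj).
congr (_ #= _)%card; apply/seteqP; split=> // i _.
by exists (enum_val i) => //; exact: enum_valK.
Qed.

(** The Boolean b treats strict and weak inequality at once: p.1 < p.2 + b
    is p.1 < p.2 for b = false and p.1 <= p.2 for b = true. *)
Lemma card_ord_pairs (n : nat) (b : bool) :
  #|[pred p : 'I_n * 'I_n | (p.1 < p.2 + b)%N]| = ('C(n, 2) + n * b)%N.
Proof.
rewrite -sum1_card -bin2_sum big_mkord.
rewrite (eq_bigl (fun p : 'I_n * 'I_n => true && (p.1 < p.2 + b)%N)) //.
rewrite -(pair_big_dep xpredT (fun i j : 'I_n => i < j + b)%N (fun _ _ => 1%N)).
rewrite (exchange_big_dep xpredT) //=.
have -> : (n * b)%N = (\sum_(j < n) b)%N by rewrite sum_nat_const card_ord.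
rewrite -big_split /=; apply: eq_bigr => j _.
have jn : (j + b <= n)%N by have := ltn_ord j; case: b; lia.
rewrite sum1_card -[RHS]card_ord -(fintype.card_image (f := widen_ord jn)); last first.
  by move=> x y /(congr1 val)/= /val_inj.
apply: eq_card => i; rewrite unfold_in; apply/idP/fintype.imageP => [ij|[k _ ->]].
  by exists (Ordinal ij) => //; apply: val_inj.
exact: (ltn_ord k).
Qed.

(** * Algebras of implications on a finite lattice *)

Section ImplicationAlgebra.
Variables (d : Order.disp_t) (T : finTBLatticeType d).

(** The pair (s, v) stands for the requirement on a set B that if B contains
    all of s then it contains v. *)
Definition implication : Type := seq T * T.

Definition implication_op (r : implication) : operation T :=
  existT _ (size r.1) (fun y => if codom y == r.1 then r.2 else \bot%O).

Definition implication_closed (r : implication) (B : set T) : Prop :=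
  (forall y, y \in r.1 -> B y) -> B r.2.

Lemma codom_tnth_in_tuple (s : seq T) : codom (tnth (in_tuple s)) = s.
Proof. by rewrite codomE map_tnth_enum. Qed.

(** The default value of [implication_op] is bottom, so a set containing
    bottom is constrained only at the tuple of premises. *)
Lemma implication_op_closedP (r : implication) (B : set T) :
  B \bot%O -> closed_under (implication_op r) B <-> implication_closed r B.
Proof.
move=> B0; split=> [Br prem | Br y By /=].
  have := Br (tnth (in_tuple r.1)); rewrite /= codom_tnth_in_tuple eqxx; apply.
  by move=> i; apply: prem; exact: mem_tnth.
case: eqP => // ycod; apply: Br => z; rewrite -ycod.
by case/codomP => i ->; exact: By.
Qed.

(** The premises are recovered as the only arguments at which the operation
    does not take the value bottom. *)
Lemma implication_op_inj (r r' : implication) :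
  r.2 != \bot%O -> implication_op r = implication_op r' -> r = r'.
Proof.
(* Stated without mention of the arity, this relation can be rewritten along
   the equality of the two operations. *)
pose fires (f : operation T) s w := exists2 y, codom y = s & projT2 f y = w.
move=> r0 rr'.
have : fires (implication_op r') r.1 r.2.
  rewrite -rr'; exists (tnth (in_tuple r.1)); rewrite /= codom_tnth_in_tuple //.
  by rewrite eqxx.
case=> y yr /=; case: eqP => [yr' e|_ e]; last by rewrite -e eqxx in r0.
by rewrite (surjective_pairing r) (surjective_pairing r') -yr yr' e.
Qed.

Variables (I : Type) (r : I -> implication).

Definition implication_algebra : algStruct :=
  AlgStruct (range (implication_op \o r)).

(** Soundness says that principal ideals satisfy all the implications,
    completeness that every set satisfying them is an ideal. *)
Hypothesis bot_implied : exists i, r i = ([::], \bot%O).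
Hypothesis sound : forall i, ((r i).2 <= \join_(y <- (r i).1) y)%O.
Hypothesis complete : forall B : set T, B \bot%O ->
  (forall i, implication_closed (r i) B) ->
  (forall x y, B x -> B y -> B (x `|` y)%O) /\
  (forall x y, B x -> (y <= x)%O -> B y).

Lemma subalgebra_bot (B : subalgebra implication_algebra) :
  subalg_set B \bot%O.
Proof.
case: bot_implied => i ri.
have /(_ (implication_op (r i))) := @subalgebraP _ B.
rewrite ri => /(_ _ (fun _ => \bot%O)) /=; rewrite if_same; apply.
  by exists i => //=; rewrite ri.
by case.
Qed.

Lemma subalgebra_implication_closed (B : subalgebra implication_algebra) i :
  implication_closed (r i) B.
Proof.
apply/implication_op_closedP; first exact: subalgebra_bot.
by apply: (subalgebraP (B := B)); exists i.
Qed.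

Lemma down_set_is_subalgebra (x : T) :
  `[< is_subalgebra (A := implication_algebra) [set y | (y <= x)%O] >].
Proof.
apply/asboolP => _ [i _ <-]; apply/implication_op_closedP; first exact: le0x.
move=> prem; apply: le_trans (sound i) _.
by rewrite big_seq; elim/big_ind: _ => [|y z yx zx|y /prem //];
  rewrite ?le0x // leUx yx.
Qed.

Definition down_set (x : T) : subalgebra implication_algebra :=
  Subalgebra (down_set_is_subalgebra x).

Definition subalgebra_sup (B : subalgebra implication_algebra) : T :=
  (\join_(x | `[< subalg_set B x >]) x)%O.

(** Every subalgebra is a principal ideal: it is closed under finite joins, so
    it contains the join of all its elements. *)
Lemma subalgebra_supP (B : subalgebra implication_algebra) (x : T) :
  subalg_set B x <-> (x <= subalgebra_sup B)%O.
Proof.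
have [BU Bdown] := complete (subalgebra_bot B)
  (@subalgebra_implication_closed B).
split=> [Bx|]; first by apply: joins_sup; apply/asboolP.
apply: Bdown; rewrite /subalgebra_sup.
elim/big_ind: _ => [|y z|y /asboolP//]; [exact: subalgebra_bot | exact: BU].
Qed.

Lemma implication_algebra_representation :
  algebraic_representation T implication_algebra.
Proof.
have supE B C : (subalgebra_sup B <= subalgebra_sup C)%O = (B <= C)%O.
  apply/idP/subalgebra_leP => [BC x|BC].
    by move=> /subalgebra_supP xB; apply/subalgebra_supP; exact: le_trans BC.
  by apply/subalgebra_supP/BC/subalgebra_supP.
have downK : cancel down_set subalgebra_sup.
  move=> x; apply: le_anti; apply/andP; split; last first.
    by apply/(subalgebra_supP (down_set x)) => /=.
  by have /subalgebra_supP /= := lexx (subalgebra_sup (down_set x)).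
apply: (@order_iso_lattice_isomorphic _ _ _ _ subalgebra_sup down_set) => //.
by move=> B; apply: le_anti; rewrite -!supE downK lexx.
Qed.

End ImplicationAlgebra.

(** * The intervals of a Christmas Tree lattice *)

Section ChristmasTree.
Variables (n : nat) (d : Order.disp_t) (T : finTBLatticeType d) (a : 'I_n -> T).

Local Notation c i j := (a i `|` a j)%O.

Hypothesis a_neq0 : forall i, a i != \bot%O.
Hypothesis a_span : forall b : T, b <> \bot%O ->
  exists! ij : 'I_n * 'I_n, (ij.1 <= ij.2)%N /\ c ij.1 ij.2 = b.
Hypothesis a_joins : forall i k : 'I_n, (i < k)%N ->
  c i k = (\join_(l < n | (i <= l <= k)%N) a l)%O.

Lemma join_atoms_neq0 (i j : 'I_n) : c i j != \bot%O.
Proof.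
by apply: contraNneq (a_neq0 i) => c0; rewrite -lex0 -c0 leUl.
Qed.

Lemma join_atoms_inj (i j k l : 'I_n) : (i <= j)%N -> (k <= l)%N ->
  c i j = c k l -> (i, j) = (k, l).
Proof.
move=> ij kl e; have [p [_ uniq]] := a_span (elimN eqP (join_atoms_neq0 i j)).
by rewrite -(uniq (i, j)) // -(uniq (k, l)).
Qed.

Lemma atom_le_join (i j l : 'I_n) : (i <= l <= j)%N -> (a l <= c i j)%O.
Proof.
move=> ilj; case: (ltngtP i j) => [ij|ji|/val_inj ij].
- by rewrite a_joins //; apply: joins_sup.
- by lia.
- suff -> : l = i by rewrite leUl.
  by apply: ord_inj; move: ilj; rewrite -ij; lia.
Qed.

(** Suppose that a l <= c i j with l < i. Then c l j <= c i j, while c l j lies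
    above a i, so that the two are equal, against the uniqueness of the
    endpoints. The case j < l is symmetric. *)
Lemma atom_le_joinE (i j l : 'I_n) : (i <= j)%N ->
  (a l <= c i j)%O = (i <= l <= j)%N.
Proof.
move=> ij; apply/idP/idP; last exact: atom_le_join.
move=> lij; case: (ltnP l i) => [li|il] /=; last case: (leqP l j) => //= jl.
- have e : c l j = c i j.
    apply: le_anti; rewrite !leUx lij !leUr !andbT /=.
    by apply: atom_le_join; rewrite (ltnW li).
  have [li'] := join_atoms_inj (leq_trans (ltnW li) ij) ij e.
  by rewrite li' ltnn in li.
- have e : c i l = c i j.
    apply: le_anti; rewrite !leUx lij !leUl /=.
    by apply: atom_le_join; rewrite ij (ltnW jl).
  have [lj'] := join_atoms_inj il ij e.
  by rewrite lj' ltnn in jl.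
Qed.

Lemma bot_or_join_atoms (x : T) :
  x = \bot%O \/ exists i j : 'I_n, (i <= j)%N /\ x = c i j.
Proof.
have [->|/eqP x0] := eqVneq x \bot%O; first by left.
by have [[i j] [[/= ij <-] _]] := a_span x0; right; exists i, j.
Qed.

Definition proper_interval : Type := {p : 'I_n * 'I_n | (p.1 < p.2)%N}.

Definition interval_implication (p : proper_interval) (t : option bool) :
    implication T :=
  let: (i, j) := val p in
  match t with
  | None => ([:: a i; a j], c i j)
  | Some false => ([:: c i j], a i)
  | Some true => ([:: c i j], c (ordS i) j)
  end.

(** The last implication gives the one constant of the algebra. *)
Definition tree_implication (k : option (proper_interval * option bool)) :
    implication T :=
  if k is Some (p, t) then interval_implication p t else ([::], \bot%O).

(** [ordS] is cyclic, but it does not wrap around below another element. *)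
Lemma val_ordS_lt (i j : 'I_n) : (i < j)%N -> ordS i = i.+1 :> nat.
Proof. by move=> ij; rewrite /= modn_small //; have := ltn_ord j; lia. Qed.

Lemma tree_implication_sound k :
  ((tree_implication k).2 <= \join_(y <- (tree_implication k).1) y)%O.
Proof.
case: k => [[[[i j] /= ij] t]|]; last by rewrite le0x.
case: t => [[]|]; rewrite /= !big_cons big_nil joinx0 ?leUl //.
rewrite leUx leUr andbT; apply: atom_le_join.
by rewrite (val_ordS_lt ij); lia.
Qed.

Lemma tree_implication_complete (B : set T) : B \bot%O ->
  (forall k, implication_closed (tree_implication k) B) ->
  (forall x y, B x -> B y -> B (x `|` y)%O) /\
  (forall x y, B x -> (y <= x)%O -> B y).
Proof.
move=> B0 Br.
have Bjoin (i j : 'I_n) : (i <= j)%N -> B (a i) -> B (a j) -> B (c i j).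
  rewrite leq_eqVlt => /predU1P[/val_inj <-|ij Bi Bj]; first by rewrite joinxx.
  apply: (Br (Some (Sub (i, j) ij, None))) => y.
  by rewrite !inE => /orP[] /eqP ->.
(* Strip the interval from the left until it starts at l, then take its left
   end; if l = j nothing is left but the atom itself. *)
have Batom (i j l : 'I_n) : (i <= l <= j)%N -> B (c i j) -> B (a l).
  have [m] := ubnP (j - i); elim: m => // m IH in i *.
  rewrite ltnS => jim ilj Bij.
  move: (ilj); case/andP; rewrite leq_eqVlt => /predU1P[/val_inj il|il] lj.
    move: lj; rewrite -il leq_eqVlt => /predU1P[/val_inj ij|ij].
      by move: Bij; rewrite -ij joinxx.
    apply: (Br (Some (Sub (i, j) ij, Some false))) => y.
    by rewrite inE => /eqP ->.
  have ij : (i < j)%N := leq_trans il lj.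
  apply: (IH (ordS i)); rewrite ?(val_ordS_lt ij); try lia.
  apply: (Br (Some (Sub (i, j) ij, Some true))) => y.
  by rewrite inE => /eqP ->.
split=> x y Bx.
- have [->|[i [j [ij xE]]]] := bot_or_join_atoms x; first by rewrite join0x.
  have [->|[k [l [kl yE]]]] := bot_or_join_atoms y; first by rewrite joinx0.
  move: Bx; rewrite xE yE => Bij Bkl.
  (* The join of two intervals is the interval [m, M] spanned by their union. *)
  pose m := if (i <= k)%N then i else k; pose M := if (j <= l)%N then l else j.
  have [mi mk jM lM] : [/\ m <= i, m <= k, j <= M & l <= M]%N.
    by rewrite /m /M; split; case: ifP; lia.
  have Bm : B (a m).
    by rewrite /m; case: ifP => _; [apply: Batom Bij | apply: Batom Bkl]; lia.
  have BM : B (a M).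
    by rewrite /M; case: ifP => _; [apply: Batom Bkl | apply: Batom Bij]; lia.
  suff -> : (c i j `|` c k l)%O = c m M by apply: Bjoin => //; lia.
  apply: le_anti; rewrite !leUx !atom_le_join; try lia.
  rewrite /= /m /M.
  by apply/andP; split; case: ifP => _; apply: lexU2;
     rewrite ?leUl ?leUr ?orbT.
- have [->|[k [l [kl ->]]]] := bot_or_join_atoms y; first by [].
  have [xE|[i [j [ij xE]]]] := bot_or_join_atoms x.
    by rewrite xE lex0 (negPf (join_atoms_neq0 _ _)).
  move: Bx; rewrite xE => Bij; rewrite leUx !atom_le_joinE //.
  by case/andP => ikj ilj; apply: Bjoin => //; apply: Batom Bij.
Qed.

Lemma interval_implication_neq0 p t : (interval_implication p t).2 != \bot%O.
Proof.
by case: p t => [[i j] ij] [[]|] //=; exact: join_atoms_neq0.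
Qed.

(** Different pairs i < j give different premises. For a fixed pair, the number
    of premises singles out the join, and a i differs from c (i+1) j by the
    uniqueness of endpoints. *)
Lemma tree_implication_op_inj :
  injective (implication_op (T := T) \o tree_implication).
Proof.
have sz p t : size (interval_implication p t).1 != 0%N.
  by case: p t => [[i j] ij] [[]|].
have op_None p t : implication_op (interval_implication p t) <>
    implication_op (tree_implication None).
  by move=> /(congr1 (@projT1 _ _))/eqP; apply: (negP (sz p t)).
have a_inj i j : a i = a j -> i = j.
  move=> e; have := @join_atoms_inj i i j j (leqnn _) (leqnn _).
  by rewrite !joinxx => /(_ e)[].
have ordS_neq (i j : 'I_n) : (i < j)%N -> ordS i = i -> False.
  by move=> ij /(congr1 (@nat_of_ord n)); rewrite (val_ordS_lt ij); lia.
case=> [[p t]|] [[q u]|] //=; last 2 first.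
- by move/op_None.
- by move/esym/op_None.
move/(implication_op_inj (interval_implication_neq0 p t)) => e.
have pq : val p = val q.
  case: p q e => [[i j] /= ij] [[k l] /= kl].
  case: t u => [[]|] [[]|] //= [];
    try by move=> /(join_atoms_inj (ltnW ij) (ltnW kl)).
  by move=> /a_inj -> /a_inj ->.
move/val_inj: pq e => {q}<-; case: p => [[i j] ij].
have Sij : (ordS i <= j)%N by rewrite (val_ordS_lt ij).
have Si_neq : c (ordS i) j <> a i.
  rewrite -(joinxx (a i)) => /(join_atoms_inj Sij (leqnn i))[Si _].
  exact: ordS_neq ij Si.
by case: t u => [[]|] [[]|] // [e];
   [case: (Si_neq e) | case: (Si_neq (esym e))].
Qed.

Lemma card_proper_interval : #|{: proper_interval}| = 'C(n, 2).
Proof.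
rewrite card_sig; have := card_ord_pairs n false; rewrite muln0 addn0 => <-.
by apply: eq_card => p; rewrite !inE addn0.
Qed.

Lemma card_tree : #|T| = ('C(n, 2) + n).+1.
Proof.
have /prednK <- : (0 < #|T|)%N by apply/card_gt0P; exists \bot%O.
rewrite -(cardC1 (\bot%O : T)) -[X in (_ + X)%N]muln1.
rewrite -[X in _ = X.+1](card_ord_pairs n true).
rewrite -(card_in_image (f := fun p => c p.1 p.2)); last first.
  move=> [i j] [k l]; rewrite !inE !addn1 !ltnS /= => ij kl.
  exact: join_atoms_inj ij kl.
congr _.+1; apply: eq_card => x; rewrite !inE; apply/idP/fintype.imageP.
- move=> /eqP x0; case: (bot_or_join_atoms x) => [/x0 []|[i [j [ij ->]]]].
  by exists (i, j); rewrite // inE addn1.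
- by move=> [p _ ->]; exact: join_atoms_neq0.
Qed.

End ChristmasTree.

Theorem proposition6 (n : nat) (d : Order.disp_t) (T : finTBLatticeType d) :
  (1 <= n)%N -> christmas_tree n T ->
  exists A : algStruct,
    [/\ algebraic_representation T A,
        ([set: A] #= `I_((n ^ 2 + n + 2) %/ 2)%N)%card
      & (ops A #= `I_((3 * n ^ 2 - 3 * n + 2) %/ 2)%N)%card].
Proof.
move=> n_gt0 [a [[_ a_cover] _ a_span [_ a_joins]]].
have a_neq0 i : a i != \bot%O.
  have [] : covers \bot%O (a i) by apply/a_cover; exists i.
  by rewrite lt0x.
have bin2n : (n * n.-1 = 2 * 'C(n, 2))%N by rewrite -mul_bin_diag bin1.
exists (implication_algebra (tree_implication a)); split.
- apply: implication_algebra_representation.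
  + by exists None.
  + exact: tree_implication_sound.
  + exact: tree_implication_complete.
- have := card_finType T; rewrite (card_tree a_neq0 a_span).
  have -> // : (('C(n, 2) + n).+1 = (n ^ 2 + n + 2) %/ 2)%N.
  nia.
- have inj := tree_implication_op_inj a_neq0 a_span.
  apply: card_eq_trans (inj_card_eq (in2W inj)) _.
  have := card_finType (option (proper_interval n * option bool)).
  rewrite card_option card_prod card_option card_bool card_proper_interval.
  have -> // : ('C(n, 2) * 3).+1 = ((3 * n ^ 2 - 3 * n + 2) %/ 2)%N.
  nia.
Qed.
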